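(* The class of Urquhart doubly preordered sets does not have the amalgamation property.
   Context: An Urquhart doubly preordered set is a set $X$ with two preorders (reflexive transitive relations) $\leq_1,\leq_2$ satisfying condition (U): for all $x,y\in X$, if $x\leq_1 y$ and $x\leq_2 y$ then $x=y$. Embeddings are injective maps preserving and reflecting both relations. A class $\mathcal K$ has the amalgamation property if for all $\mathbf A,\mathbf B,\mathbf C\in\mathcal K$ and embeddings $\iota_1:\mathbf C\to\mathbf A$, $\kappa_1:\mathbf C\to\mathbf B$ there exist $\mathbf D\in\mathcal K$ and embeddings $\iota:\mathbf A\to\mathbf D$, $\kappa:\mathbf B\to\mathbf D$ with $\iota\circ\iota_1=\kappa\circ\kappa_1$. *)

(* Defs.v *)
From Stdlib Require Import Relations FinFun.

Record birelational : Type := Birelational {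
  carrier :> Type;
  le1 : relation carrier;
  le2 : relation carrier
}.

Arguments le1 {X} _ _ : rename.
Arguments le2 {X} _ _ : rename.

Record urquhart_doubly_preordered (X : birelational) : Prop := {
  le1_preorder : preorder X le1;
  le2_preorder : preorder X le2;
  conditionU : forall x y : X, le1 x y -> le2 x y -> x = y
}.

Record embedding (X Y : birelational) (f : X -> Y) : Prop := {
  embedding_injective : Injective f;
  embedding_le1 : forall x y : X, le1 x y <-> le1 (f x) (f y);
  embedding_le2 : forall x y : X, le2 x y <-> le2 (f x) (f y)
}.

Arguments embedding {X Y} f.

Definition amalgamation_property (K : birelational -> Prop) : Prop :=
  forall A B C : birelational, K A -> K B -> K C ->
  forall (iota1 : C -> A) (kappa1 : C -> B),
  embedding iota1 -> embedding kappa1 ->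
  exists (D : birelational) (iota : A -> D) (kappa : B -> D),
    K D /\ embedding iota /\ embedding kappa /\
    (forall c : C, iota (iota1 c) = kappa (kappa1 c)).

(* Main.v *)
Require Import Defs.
From Stdlib Require Import Relations.

(** Over the antichain [{c1, c2}], adjoin a point [a] with [a <=1 c1] and
    [a <=2 c2] on one side, and a point [b] with [c1 <=1 b] and [c2 <=2 b] on
    the other. In an amalgam, transitivity through [c1] and [c2] gives
    [a <=1 b] and [a <=2 b], so (U) identifies [a] with [b]; then [b <=1 c1],
    which fails in the second structure. *)

(* [c1] is [true], [c2] is [false]; the adjoined point is [None]. *)
Definition antichain : birelational := Birelational bool eq eq.

Definition with_lower_point : birelational :=
  Birelational (option bool)
    (fun x y => x = y \/ (x = None /\ y = Some true))
    (fun x y => x = y \/ (x = None /\ y = Some false)).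

Definition with_upper_point : birelational :=
  Birelational (option bool)
    (fun x y => x = y \/ (x = Some true /\ y = None))
    (fun x y => x = y \/ (x = Some false /\ y = None)).

Lemma antichain_urquhart : urquhart_doubly_preordered antichain.
Proof.
  split; [split | split |]; simpl; unfold reflexive, transitive; congruence.
Qed.

(** Each relation adds to equality one pair, from [None] to another point, so two added pairs never
    compose; the two pairs end at different points, whence (U). *)
Lemma with_lower_point_urquhart : urquhart_doubly_preordered with_lower_point.
Proof.
  split; [split | split |]; simpl; unfold reflexive, transitive;
    intuition congruence.
Qed.

Lemma with_upper_point_urquhart : urquhart_doubly_preordered with_upper_point.
Proof.
  split; [split | split |]; simpl; unfold reflexive, transitive;
    intuition congruence.
Qed.

(** Every added pair involves [None], so both relations restrict to equality on the image of
    [Some]. *)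
Lemma Some_embedding_lower : @embedding antichain with_lower_point Some.
Proof.
  split; simpl; [intros x y |..]; intuition congruence.
Qed.

Lemma Some_embedding_upper : @embedding antichain with_upper_point Some.
Proof.
  split; simpl; [intros x y |..]; intuition congruence.
Qed.

Theorem theorem5p1 : ~ amalgamation_property urquhart_doubly_preordered.
Proof.
  intros AP.
  destruct (AP _ _ _ with_lower_point_urquhart with_upper_point_urquhart
              antichain_urquhart _ _ Some_embedding_lower Some_embedding_upper)
    as (D & i & k & [[_ trans1] [_ trans2] U] & [_ i1 i2] & [_ k1 k2] & comm).
  assert (c1 : i (Some true) = k (Some true)) by exact (comm true).
  assert (c2 : i (Some false) = k (Some false)) by exact (comm false).
  assert (a_c1 : le1 (i None) (k (Some true))).
  { rewrite <- c1. apply i1. simpl. auto. }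
  assert (a_c2 : le2 (i None) (k (Some false))).
  { rewrite <- c2. apply i2. simpl. auto. }
  assert (ab : i None = k None).
  { apply U.
    - apply (trans1 _ _ _ a_c1). apply k1. simpl. auto.
    - apply (trans2 _ _ _ a_c2). apply k2. simpl. auto. }
  rewrite ab in a_c1.
  (* As [k] reflects [le1], [None] would lie below [Some true] in [with_upper_point], where only the
     reverse pair was added. *)
  apply k1 in a_c1. simpl in a_c1. intuition congruence.
Qed.
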